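(* Let $K$ be a field, $S=K[x_0,\ldots,x_n]$ with $x_0<x_1<\cdots<x_n$, let $J\subseteq S$ be a strongly stable monomial ideal with minimal monomial basis $B_J$, and let $G=\{f_\alpha=x^\alpha-\sum c_{\alpha\gamma}x^\gamma : Ht(f_\alpha)=x^\alpha\in B_J\}$ be a $J$-marked set. Then every polynomial of $S$ has a $J$-reduced form modulo $(G)$.
   Context: A term is a monomial $x^\alpha=x_0^{\alpha_0}\cdots x_n^{\alpha_n}$. A monomial ideal $J$ is strongly stable if for every term $x^\alpha\in J$ and all $0\le i<j\le n$ with $\alpha_i>0$, the term $x_j x^\alpha/x_i$ belongs to $J$. $B_J$ is the minimal set of monomial generators of $J$ and $\mathcal N(J)$ is the set of terms not in $J$. $Supp(h)$ is the set of terms occurring in $h$ with non-zero coefficient. A marked polynomial is a polynomial $f$ with a specified term $Ht(f)\in Supp(f)$, its head term. A $J$-marked set is a finite set $G$ of homogeneous marked polynomials $f_\alpha=x^\alpha-\sum c_{\alpha\gamma}x^\gamma$, with $c_{\alpha\gamma}\in K$ and $Ht(f_\alpha)=x^\alpha$, whose head terms are pairwise different and form exactly $B_J$, and such that every $x^\gamma$ appearing belongs to $\mathcal N(J)$. A $J$-reduced form modulo an ideal $I$ of a polynomial $h$ is a polynomial $h_0$ with $h-h_0\in I$ and $Supp(h_0)\subseteq\mathcal N(J)$ (if $I$ and $h$ are homogeneous, $h_0$ is required to be homogeneous too). *)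

(* Defs.v *)
From HB Require Import structures.
From mathcomp Require Import all_boot all_order all_algebra.
From mathcomp Require Import mpoly.

Set Implicit Arguments.
Unset Strict Implicit.
Unset Printing Implicit Defensive.

Import GRing.Theory.
Local Open Scope ring_scope.

(* Ideals are Prop-valued predicates: MathComp's [idealr] only covers proper,
   decidable ideals, whereas the zero ideal and the whole ring are both
   allowed here and no decidability is assumed. *)
Definition ideal_gen (R : comNzRingType) (A : R -> Prop) (p : R) : Prop :=
  exists2 s : seq (R * R),
    (forall c, c \in s -> A c.2) & p = \sum_(c <- s) c.1 * c.2.

Section MarkedSets.

Variables (K : fieldType) (n : nat).

(* A term x^a is represented by its exponent [a : 'X_{1..n}]; the polynomial
   it denotes is ['X_[a]]. *)
Definition term_set (B : 'X_{1..n} -> Prop) (p : {mpoly K[n]}) : Prop :=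
  exists2 m, B m & p = 'X_[m].

Definition generated_by_terms (J : {mpoly K[n]} -> Prop)
    (B : 'X_{1..n} -> Prop) : Prop :=
  forall p, J p <-> ideal_gen (term_set B) p.

Definition monomial_ideal (J : {mpoly K[n]} -> Prop) : Prop :=
  exists B, generated_by_terms J B.

(* The truncated exponent subtraction is exact since [m i > 0].  The order
   x_0 < x_1 < ... of the variables is the order of their indices. *)
Definition strongly_stable (J : {mpoly K[n]} -> Prop) : Prop :=
  monomial_ideal J /\
  forall (m : 'X_{1..n}) (i j : 'I_n),
    J 'X_[m] -> (i < j)%N -> (0 < m i)%N -> J 'X_[(m - U_(i) + U_(j))%MM].

Definition minimal_monomial_basis (J : {mpoly K[n]} -> Prop)
    (B : 'X_{1..n} -> Prop) : Prop :=
  generated_by_terms J B /\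
  forall B' : 'X_{1..n} -> Prop,
    (forall m, B' m -> B m) -> generated_by_terms J B' ->
    forall m, B m -> B' m.

Definition normal_terms (J : {mpoly K[n]} -> Prop) (m : 'X_{1..n}) : Prop :=
  ~ J 'X_[m].

Definition homogeneous (p : {mpoly K[n]}) : Prop :=
  exists d, p \is d.-homog.

Definition homogeneous_ideal (I : {mpoly K[n]} -> Prop) : Prop :=
  exists2 A : {mpoly K[n]} -> Prop,
    (forall p, A p -> homogeneous p) & (forall p, I p <-> ideal_gen A p).

Record marked_poly := MarkedPoly {
  mp_val : {mpoly K[n]} * 'X_{1..n};
  mp_valP : mp_val.2 \in msupp mp_val.1
}.

HB.instance Definition _ := [isSub for mp_val].
HB.instance Definition _ := [Equality of marked_poly by <:].

Definition mp_poly (f : marked_poly) : {mpoly K[n]} := (mp_val f).1.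
Coercion mp_poly : marked_poly >-> mpoly.
Definition Ht (f : marked_poly) : 'X_{1..n} := (mp_val f).2.

(* The third clause says that each polynomial of [G] has the shape
   x^a - sum_c k_c x^c with head term x^a and every x^c outside [J]. *)
Definition marked_set (J : {mpoly K[n]} -> Prop) (B : 'X_{1..n} -> Prop)
    (G : seq marked_poly) : Prop :=
  [/\ uniq [seq Ht f | f <- G],
      forall m, B m <-> m \in [seq Ht f | f <- G]
    & forall f, f \in G ->
        [/\ homogeneous f, f@_(Ht f) = 1
          & forall m, m \in msupp f -> m != Ht f -> normal_terms J m]].

Definition ideal_of (G : seq marked_poly) : {mpoly K[n]} -> Prop :=
  ideal_gen (fun p => p \in [seq mp_poly f | f <- G]).

Definition reduced_form (J I : {mpoly K[n]} -> Prop)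
    (h h0 : {mpoly K[n]}) : Prop :=
  [/\ I (h - h0),
      forall m, m \in msupp h0 -> normal_terms J m
    & homogeneous_ideal I -> homogeneous h -> homogeneous h0].

End MarkedSets.

(* Main.v *)
Require Import Defs.
From mathcomp Require Import all_boot all_order all_algebra.
From mathcomp Require Import mpoly.
Import GRing.Theory.
Local Open Scope ring_scope.

(** By linearity it suffices to reduce terms.  Terms outside [J] are reduced,
and a term of [B_J] is reduced by its marked polynomial.  Any other term of [J]
is [x_i x^e] with [x^e] in [J]; it is handled by induction on its degree and,
in a fixed degree, on [i].  If [r] is a reduced form of [x^e], then
[x_i x^e = x_i r] modulo [(G)].  Let [x_i x^c] be a term of [x_i r] that lies in
[J] but not in [B_J], say [x_i x^c = x_j x^e'] with [x^e'] in [J].  As [x^c] is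
not in [J], [j <> i]; and [i < j] is impossible, since [x^c = x_j x^e' / x_i]
would be in [J] by strong stability.  Hence [j < i], and induction applies. *)

Section IdealGen.

Context {R : comNzRingType} {A : R -> Prop}.
Implicit Types p q : R.

Lemma ideal_gen0 : ideal_gen A 0.
Proof. by exists [::]; rewrite ?big_nil. Qed.

Lemma ideal_gen_gen p : A p -> ideal_gen A p.
Proof.
move=> Ap; exists [:: (1, p)]; last by rewrite big_seq1 mul1r.
by move=> c; rewrite inE => /eqP ->.
Qed.

Lemma ideal_genD p q : ideal_gen A p -> ideal_gen A q -> ideal_gen A (p + q).
Proof.
move=> [s sA ->] [t tA ->]; exists (s ++ t); last by rewrite big_cat.
by move=> c; rewrite mem_cat => /orP[/sA|/tA].
Qed.

Lemma ideal_genMl q p : ideal_gen A p -> ideal_gen A (q * p).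
Proof.
move=> [s sA ->]; exists [seq (q * c.1, c.2) | c <- s].
  by move=> c /mapP[c' /sA Ac' ->].
by rewrite big_map mulr_sumr; apply: eq_bigr => c _; rewrite mulrA.
Qed.

End IdealGen.

Section TermIdeal.

Context {K : fieldType} {n : nat}.
Context {J : {mpoly K[n]} -> Prop} {B : 'X_{1..n} -> Prop}.
Hypothesis JB : generated_by_terms J B.

Lemma gen_term_mem b e : B b -> J 'X_[b + e].
Proof.
move=> Bb; apply/JB; rewrite addmC mpolyXD.
by apply/ideal_genMl/ideal_gen_gen; exists b.
Qed.

(** The coefficient of ['X_[m]] in the combination of generators is 1, so some summand [c.1 *
    'X_[b]] contains this term, and every term of that summand is a multiple of ['X_[b]]. *)
Lemma term_mem_gen m : J 'X_[m] -> exists2 b, B b & (b <= m)%MM.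
Proof.
move=> /JB[s sB mE].
have : ('X_[m] : {mpoly K[n]})@_m != 0 by rewrite mcoeffX eqxx oner_eq0.
rewrite mE raddf_sum /=; elim: s sB {mE} => [|c s IHs] sB.
  by rewrite big_nil eqxx.
have [b Bb cE] := sB c (mem_head _ _).
rewrite big_cons cE; have [bm|bm] := boolP (m \in msupp (c.1 * 'X_[b])).
  move: bm; rewrite (perm_mem (msuppMX _ _)) => /mapP[k _ ->] _.
  by exists b; rewrite ?lem_addr.
rewrite (memN_msupp_eq0 bm) add0r; apply: IHs => c' c's.
by apply: sB; rewrite inE c's orbT.
Qed.

End TermIdeal.

Section TermReduction.

Context {K : fieldType} {n : nat}.
Variables (J : {mpoly K[n]} -> Prop) (A : {mpoly K[n]} -> Prop).
Implicit Types (m e : 'X_{1..n}) (p r : {mpoly K[n]}).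

(** The last clause preserves the degree itself and not only homogeneity: the induction on degree in
    [red_term] relies on it. *)
Definition reduces p r : Prop :=
  [/\ ideal_gen A (p - r),
      forall m, m \in msupp r -> normal_terms J m
    & forall d, p \is d.-homog -> r \is d.-homog].

Definition reducible p : Prop := exists r, reduces p r.

Lemma reducible_lin p :
  (forall m, m \in msupp p -> reducible 'X_[m]) -> reducible p.
Proof.
(* The list of terms is separated from the support of [p], whose coefficients stay fixed, so that
   induction on the list is possible. *)
suff lin (s : seq 'X_{1..n}) : (forall m, m \in s -> reducible 'X_[m]) ->
    exists r, [/\ ideal_gen A (\sum_(m <- s) p@_m *: 'X_[m] - r),
      forall m, m \in msupp r -> normal_terms J m
    & forall d, (forall m, m \in s -> mdeg m = d) -> r \is d.-homog].
  move=> /lin[r [Ir Nr Hr]]; exists r; split=> //; first by rewrite {1}[p]mpolyE.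
  by move=> d /dhomogP pd; apply: Hr => m /pd.
elim: s => [_|m s IHs sP].
  exists 0; split=> [|m|d _]; last exact: dhomog0.
    by rewrite big_nil subr0; apply: ideal_gen0.
  by rewrite msupp0.
have [|r [Ir Nr Hr]] := IHs; first by move=> k ks; apply: sP; rewrite inE ks orbT.
have [q [Iq Nq Hq]] := sP m (mem_head _ _).
exists (p@_m *: q + r); split=> [|k|d sd].
- rewrite big_cons opprD addrACA -scalerBr -mul_mpolyC.
  by apply: ideal_genD => //; apply: ideal_genMl.
- by move=> /msuppD_le; rewrite mem_cat => /orP[/msuppZ_le/Nq|/Nr].
- rewrite rpredD ?rpredZ //; last by apply: Hr => k ks; apply: sd; rewrite inE ks orbT.
  by apply: Hq; rewrite dhomogX; apply/eqP/sd/mem_head.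
Qed.

End TermReduction.

Section MarkedReduction.

Context {K : fieldType} {n : nat}.
Context {J : {mpoly K[n]} -> Prop} {BJ : 'X_{1..n} -> Prop}.
Context {G : seq (marked_poly K n)}.
Hypotheses (J_stable : strongly_stable J) (J_gen : generated_by_terms J BJ).
Hypothesis G_marked : marked_set J BJ G.
Implicit Types (m e : 'X_{1..n}).

Let red := reducible J (fun p => p \in [seq mp_poly f | f <- G]).

Lemma red_normal m : normal_terms J m -> red 'X_[m].
Proof.
move=> Nm; exists 'X_[m]; split=> [|k|//]; first by rewrite subrr; apply: ideal_gen0.
by rewrite msuppX inE => /eqP ->.
Qed.

Lemma red_basis m : BJ m -> red 'X_[m].
Proof.
case: G_marked => _ BE GP /BE/mapP[f fG mE].
have [[d fd] f1 fN] := GP f fG.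
exists ('X_[m] - mp_poly f); split=> [|k|d'].
- by rewrite subKr; apply: ideal_gen_gen; apply: map_f.
- rewrite mcoeff_msupp mcoeffB mcoeffX; case: (eqVneq m k) => [<-|mk].
    by rewrite mE f1 subrr eqxx.
  rewrite sub0r oppr_eq0 -mcoeff_msupp => kf.
  by apply: fN => //; rewrite -mE eq_sym.
(* The head term lies in the support, so the degree of the homogeneous [f] is that of [m]. *)
- have mf : m \in msupp (mp_poly f) by rewrite mcoeff_msupp mE f1 oner_eq0.
  move=> md; rewrite rpredB //; move: md; rewrite dhomogX => /eqP <-.
  by have /dhomogP/(_ m mf) -> := fd.
Qed.

(** The three cases are decided by testing divisibility by the finitely many head terms. For a
    proper multiple of [b], dividing by a variable whose exponent exceeds that in [b] leaves a
    multiple of [b]. *)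
Lemma term_cases m :
  [\/ normal_terms J m, BJ m | exists i e, m = (e + U_(i))%MM /\ J 'X_[e]].
Proof.
case: G_marked => _ BE _.
have [/hasP[b /BE Bb bm]|noB] := boolP (has (fun b => b <= m)%MM [seq Ht f | f <- G]).
  have [->|neq] := eqVneq m b; first by constructor 2.
  constructor 3.
  have [i bi] : exists i, (b i < m i)%N.
    apply/existsP; apply: contraNT neq => /existsPn nlt; apply/eqP/mnmP => i.
    by apply/eqP; rewrite eqn_leq leqNgt nlt; apply: (mnm_lepP bm).
  have mi : (U_(i) <= m)%MM by rewrite lep1mP -lt0n (leq_ltn_trans _ bi).
  exists i, (m - U_(i))%MM; split; first by rewrite submK.
  have /submK <- : (b <= m - U_(i))%MM.
    apply/mnm_lepP => k; rewrite mnmBE mnm1E; case: (eqVneq i k) => [<-|_].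
      by rewrite subn1 -ltnS prednK // (leq_ltn_trans _ bi).
    by rewrite subn0; apply: (mnm_lepP bm).
  by rewrite addmC; apply: gen_term_mem J_gen _ _ Bb.
constructor 1 => /(term_mem_gen J_gen)[b /BE bG bm].
by case/hasP: noB; exists b.
Qed.

Lemma red_term m : red 'X_[m].
Proof.
have [d] := ubnP (mdeg m); elim: d m => // d IHd m; rewrite ltnS => md.
(* Inner induction on a strict bound [k] for the variable index, with the degree bound [d] of the
   outer induction kept. *)
suff red_mul k : forall (i : 'I_n) e, (i < k)%N -> (mdeg (e + U_(i)) <= d)%N ->
    J 'X_[e] -> red 'X_[e + U_(i)].
  case: (term_cases m) => [/red_normal//|/red_basis//|[i [e [mE Je]]]].
  by rewrite mE; apply: (red_mul i.+1); rewrite -?mE.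
elim: k => // k IHk i e; rewrite ltnS => ik ed Je.
have [|r [Ir Nr Hr]] := IHd e; first by rewrite -addn1 -(mdeg1 i) -mdegD.
have re : r \is (mdeg e).-homog by apply: Hr; rewrite dhomogX.
have [q [Iq Nq Hq]] : red (r * 'X_i).
  apply: reducible_lin => c; rewrite (perm_mem (msuppMX _ _)) => /mapP[c' c'r ->].
  have Nc' := Nr c' c'r; have c'e : mdeg c' = mdeg e by have /dhomogP/(_ _ c'r) := re.
  case: (term_cases (U_(i) + c')) => [/red_normal//|/red_basis//|[j [e' [cE Je']]]].
  case: (ltngtP i j) => [ij|ji|/ord_inj ij].
  - case: Nc'; have e'i : (0 < e' i)%N.
      (* Exponents of the variable [i] are compared: it is positive on the left, and [U_(j)]
         contributes nothing. *)
      move/mnmP/(_ i): cE; rewrite !mnmDE !mnm1E eqxx (_ : j == i = false) ?addn0 => [<-//|].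
      by rewrite eq_sym; apply/negbTE; rewrite neq_ltn ij.
    have -> : c' = (e' - U_(i) + U_(j))%MM.
      have ei : (U_(i) <= e')%MM by rewrite lep1mP -lt0n.
      by rewrite addmC addmBA ?ei // [(U_(j) + _)%MM]addmC -cE addmC addmK.
    by case: J_stable => _; apply.
  - rewrite cE; apply: IHk => //; first exact: leq_trans ji ik.
    (* The degree has not grown, because [r] is homogeneous of degree [mdeg e]. *)
    by rewrite -cE addmC mdegD c'e -mdegD.
  - by case: Nc'; move: cE; rewrite ij addmC => /addIm ->.
exists q; split=> // [|d' ed'].
  (* The difference splits as [('X_[e] - r) * 'X_i + (r * 'X_i - q)]. *)
  rewrite mpolyXD -(subrK (r * 'X_i) ('X_[e] * _)) -addrA -mulrBl mulrC.
  by apply: ideal_genD => //; apply: ideal_genMl.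
apply: Hq; move: ed'; rewrite dhomogX => /eqP <-.
by rewrite /= mdegD mdeg1; apply: dhomogM => //; rewrite dhomogX /= mdeg1.
Qed.

End MarkedReduction.

Theorem theorem2p2 (K : fieldType) (n : nat)
    (J : {mpoly K[n.+1]} -> Prop) (BJ : 'X_{1..n.+1} -> Prop)
    (G : seq (marked_poly K n.+1)) :
  strongly_stable J ->
  minimal_monomial_basis J BJ ->
  marked_set J BJ G ->
  forall h : {mpoly K[n.+1]}, exists h0, reduced_form J (ideal_of G) h h0.
Proof.
move=> J_stable [J_gen _] G_marked h.
have [h0 [I0 N0 H0]] :
    reducible J (fun p => p \in [seq mp_poly f | f <- G]) h.
  by apply: reducible_lin => m _; apply: red_term J_stable J_gen G_marked m.
by exists h0; split=> // _ [d /H0]; exists d.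
Qed.
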